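(* For all $a,b\in\mathbb{N}$ and all $p_1,\ldots,p_a,q_1,\ldots,q_b\in\mathbb{N}$, the following identity holds in $\mathbb{Q}\langle x,y\rangle$: $$\begin{aligned} z_{p_a}\cdots z_{p_1}\mathbin{\mathrm{sh}} z_{q_b}\cdots z_{q_1} &=\sum_{\tau=0}^{q_b-1}\binom{p_a-1+\tau}{\tau}\,z_{p_a+\tau}\bigl(z_{p_{a-1}}\cdots z_{p_1}\mathbin{\mathrm{sh}} z_{q_b-\tau}z_{q_{b-1}}\cdots z_{q_1}\bigr)\\ &\quad+\sum_{\tau=0}^{p_a-1}\binom{q_b-1+\tau}{\tau}\,z_{q_b+\tau}\bigl(z_{p_a-\tau}z_{p_{a-1}}\cdots z_{p_1}\mathbin{\mathrm{sh}} z_{q_{b-1}}\cdots z_{q_1}\bigr).\end{aligned}$$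
   Context: $\mathbb{N}=\{1,2,3,\ldots\}$. $\mathfrak{H}=\mathbb{Q}\langle x,y\rangle$ is the non-commutative polynomial algebra over $\mathbb{Q}$ in the indeterminates $x,y$ (juxtaposition denotes concatenation), and $z_p=x^{p-1}y$ for $p\in\mathbb{N}$. The shuffle product $\mathrm{sh}$ is the $\mathbb{Q}$-bilinear product on $\mathfrak{H}$ determined by $1\mathbin{\mathrm{sh}}w=w\mathbin{\mathrm{sh}}1=w$ and $u_1w_1\mathbin{\mathrm{sh}}u_2w_2=u_1(w_1\mathbin{\mathrm{sh}}u_2w_2)+u_2(u_1w_1\mathbin{\mathrm{sh}}w_2)$ for words $w,w_1,w_2$ and letters $u_1,u_2\in\{x,y\}$. Concatenation binds tighter than $\mathrm{sh}$, i.e. $u_1w_1\mathbin{\mathrm{sh}}u_2w_2$ means $(u_1w_1)\mathbin{\mathrm{sh}}(u_2w_2)$. Empty products are $1$ (so $z_{p_{a-1}}\cdots z_{p_1}=1$ if $a=1$, and $z_{q_{b-1}}\cdots z_{q_1}=1$ if $b=1$); empty sums are $0$. *)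

(* Defs.v *)
From HB Require Import structures.
From mathcomp Require Import all_boot all_order all_algebra finmap.
From mathcomp.multinomials Require Import monalg.

Set Implicit Arguments.
Unset Strict Implicit.
Unset Printing Implicit Defensive.

Import GRing.Theory.
Local Open Scope ring_scope.

Inductive letter : predArgType := letter_x | letter_y.

Definition bool_of_letter (u : letter) : bool :=
  if u is letter_x then false else true.
Definition letter_of_bool (c : bool) : letter :=
  if c then letter_y else letter_x.
Fact bool_of_letterK : cancel bool_of_letter letter_of_bool.
Proof. by case. Qed.
HB.instance Definition _ := Choice.copy letter (can_type bool_of_letterK).

(* Q<x,y>, as the algebra of the free monoid on {x, y} over Q. *)
Notation ncpoly := {malg rat[{fmonom letter}]}.

Definition word (s : seq letter) : ncpoly := << FMonom s >>.

Notation Qx := (word [:: letter_x]).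
Notation Qy := (word [:: letter_y]).

(* Meant for p >= 1: the truncated subtraction makes the junk value z 0 = y. *)
Definition z (p : nat) : ncpoly := Qx ^+ (p - 1) * Qy.

(* z_(p n) ... z_(p 1), with decreasing indices, and 1 when n = 0. *)
Definition zprod (p : nat -> nat) (n : nat) : ncpoly :=
  \prod_(i <- rev (iota 1 n)) z (p i).

Fixpoint shuffle_word (s : seq letter) : seq letter -> ncpoly :=
  match s with
  | [::] => word
  | u1 :: s' =>
      fix shuffle_s (t : seq letter) : ncpoly :=
        match t with
        | [::] => word s
        | u2 :: t' =>
            word [:: u1] * shuffle_word s' t + word [:: u2] * shuffle_s t'
        end
  end.

(* The bilinear extension of shuffle_word. *)
Definition shuffle (f g : ncpoly) : ncpoly :=
  \sum_(s <- msupp f) \sum_(t <- msupp g) (f@_s * g@_t) *: shuffle_word s t.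

Notation "f \sh g" := (shuffle f g)
  (at level 45, no associativity) : ring_scope.

Fact word_cat s t : word s * word t = word (s ++ t).
Proof.
rewrite /word malgM_def fgmulUU mulr1; congr << _ >>.
by apply/eqP; rewrite fmP fmM.
Qed.

Fact word_nil : word [::] = 1.
Proof. by congr << _ >>; apply/eqP; rewrite fmP fm1. Qed.

Fact shuffle_words s t : word s \sh word t = shuffle_word s t.
Proof.
by rewrite /shuffle !msuppU1 !big_seq_fset1 !mcoeffUU mulr1 scale1r.
Qed.

Fact shuffle1w s : 1 \sh word s = word s.
Proof. by rewrite -word_nil shuffle_words. Qed.

Fact shufflew1 s : word s \sh 1 = word s.
Proof. by rewrite -word_nil shuffle_words; case: s. Qed.

Fact shuffle_cons u1 s u2 t :
  (word [:: u1] * word s) \sh (word [:: u2] * word t)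
  = word [:: u1] * (word s \sh (word [:: u2] * word t))
    + word [:: u2] * ((word [:: u1] * word s) \sh word t).
Proof. by rewrite !word_cat !shuffle_words. Qed.

Fact shuffleEw (d e : {fset {fmonom letter}}) (f g : ncpoly) :
  (msupp f `<=` d)%fset -> (msupp g `<=` e)%fset ->
  f \sh g = \sum_(s <- d) \sum_(t <- e) (f@_s * g@_t) *: shuffle_word s t.
Proof.
move=> fd ge; rewrite /shuffle (big_fset_incl _ fd) /=; last first.
  by move=> s _ /mcoeff_outdom ->; rewrite big1 // => t _; rewrite mul0r scale0r.
apply: eq_bigr => s _; apply: (big_fset_incl _ ge) => t _ /mcoeff_outdom ->.
by rewrite mulr0 scale0r.
Qed.

Fact shuffleDl (f1 f2 g : ncpoly) : (f1 + f2) \sh g = f1 \sh g + f2 \sh g.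
Proof.
pose d := (msupp f1 `|` msupp f2)%fset; pose e := msupp g.
rewrite !(@shuffleEw d e) ?fsubsetUl ?fsubsetUr ?msuppD_le ?fsubset_refl //.
rewrite -big_split; apply: eq_bigr => s _.
rewrite -big_split; apply: eq_bigr => t _ /=.
by rewrite mcoeffD mulrDl scalerDl.
Qed.

Fact shuffleDr (f g1 g2 : ncpoly) : f \sh (g1 + g2) = f \sh g1 + f \sh g2.
Proof.
pose d := msupp f; pose e := (msupp g1 `|` msupp g2)%fset.
rewrite !(@shuffleEw d e) ?fsubsetUl ?fsubsetUr ?msuppD_le ?fsubset_refl //.
rewrite -big_split; apply: eq_bigr => s _.
rewrite -big_split; apply: eq_bigr => t _ /=.
by rewrite mcoeffD mulrDr scalerDl.
Qed.

Fact shuffleZl c (f g : ncpoly) : (c *: f) \sh g = c *: (f \sh g).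
Proof.
rewrite !(@shuffleEw (msupp f) (msupp g)) ?msuppZ_le ?fsubset_refl //.
rewrite scaler_sumr; apply: eq_bigr => s _.
by rewrite scaler_sumr; apply: eq_bigr => t _; rewrite mcoeffZ scalerA mulrA.
Qed.

Fact shuffleZr c (f g : ncpoly) : f \sh (c *: g) = c *: (f \sh g).
Proof.
rewrite !(@shuffleEw (msupp f) (msupp g)) ?msuppZ_le ?fsubset_refl //.
rewrite scaler_sumr; apply: eq_bigr => s _.
rewrite scaler_sumr; apply: eq_bigr => t _.
by rewrite mcoeffZ scalerA mulrCA.
Qed.

(* Main.v *)
Require Import Defs.
From mathcomp Require Import all_boot all_order all_algebra finmap.
From mathcomp.multinomials Require Import monalg.

Import GRing.Theory.
Local Open Scope ring_scope.

(** Only the leading factors of the two words matter: the claim is an instance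
    of an expansion of x^m y w \sh x^n y v for arbitrary words w and v, with
    m = p_a - 1 and n = q_b - 1.  By iterating the defining recursion of the
    shuffle, a letter of the run x^m or x^n is removed at each step until a y
    is taken.  If it is the y of the left word, and t letters x of the right
    run are already used, then the output so far is x^(m+t) y, obtained in
    C(m+t, t) interleavings, and w \sh x^(n-t) y v is still to be computed;
    the second sum is the symmetric case.

    Both sums have the shape [run_expansion x f m n], with the rest of the
    computation abstracted into f.  Such sums obey recursion equations (the
    essential one, [run_expansionSS], is Pascal's rule) that match those of the
    shuffle, so [run_expansion_rec] identifies the two by induction on m and n.
    The abstraction to an arbitrary ring there also spares the unifier from
    unfolding the product of the monoid algebra. *)

(** The sum over t <= n of C(m+t, t) copies of x^(m+t) f(n-t): the output
    x^(m+t) merges a run of m letters x with the first t letters x of a run of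
    n, and f is applied to the number n-t of letters left in the latter. *)
Definition run_expansion {R : pzRingType} (x : R) (f : nat -> R) (m n : nat) :=
  \sum_(0 <= t < n.+1) (x ^+ (m + t) * f (n - t)%N) *+ 'C(m + t, t).

Lemma run_expansion00 (R : pzRingType) (x : R) f : run_expansion x f 0 0 = f 0%N.
Proof. by rewrite /run_expansion big_nat1 mul1r. Qed.

Lemma run_expansion0S (R : pzRingType) (x : R) f n :
  run_expansion x f 0 n.+1 = f n.+1 + x * run_expansion x f 0 n.
Proof.
rewrite /run_expansion big_nat_recl // mul1r subn0 mulr1n mulr_sumr.
congr (_ + _); apply: eq_bigr => t _.
by rewrite !add0n !binn !mulr1n exprS subSS mulrA.
Qed.

Lemma run_expansionS0 (R : pzRingType) (x : R) f m :
  run_expansion x f m.+1 0 = x * run_expansion x f m 0.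
Proof. by rewrite /run_expansion !big_nat1 !bin0 !mulr1n !addn0 exprS mulrA. Qed.

Lemma run_expansionSS (R : pzRingType) (x : R) f m n :
  run_expansion x f m.+1 n.+1
  = x * run_expansion x f m n.+1 + x * run_expansion x f m.+1 n.
Proof.
rewrite /run_expansion !mulr_sumr.
rewrite big_nat_recl // [in RHS]big_nat_recl // -addrA -big_split /=.
congr (_ + _); first by rewrite !addn0 !bin0 !mulr1n exprS mulrA.
apply: eq_bigr => t _.
rewrite !mulrnAr !mulrA -!exprS !subSS !addSn !addnS.
by rewrite -mulrnDr -binS.
Qed.

(** The recursion on F is that of the shuffle of words starting with runs of m
    and n letters x: f n is the contribution of taking the letter that follows
    the left run when that run is exhausted and n letters x remain on the right;
    g m is the symmetric contribution. *)
Lemma run_expansion_rec (R : pzRingType) (x : R) f g (F : nat -> nat -> R) :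
    F 0%N 0%N = f 0%N + g 0%N ->
    (forall n, F 0%N n.+1 = f n.+1 + x * F 0%N n) ->
    (forall m, F m.+1 0%N = x * F m 0%N + g m.+1) ->
    (forall m n, F m.+1 n.+1 = x * F m n.+1 + x * F m.+1 n) ->
  forall m n, F m n = run_expansion x f m n + run_expansion x g n m.
Proof.
move=> F00 F0S FS0 FSS; elim=> [|m IHm]; elim=> [|n IHn].
- by rewrite !run_expansion00.
- by rewrite run_expansion0S run_expansionS0 -addrA -mulrDr -IHn.
- by rewrite run_expansion0S run_expansionS0 addrCA -mulrDr -IHm addrC.
- rewrite !run_expansionSS [X in _ + X]addrC addrACA -!mulrDr -IHm -IHn mulrDr.
  exact: FSS.
Qed.

Lemma shuffle_word_runs (m n : nat) (w v : seq letter) :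
  let xy k s := nseq k letter_x ++ letter_y :: s in
  shuffle_word (xy m w) (xy n v)
  = run_expansion Qx (fun k => Qy * shuffle_word w (xy k v)) m n
    + run_expansion Qx (fun k => Qy * shuffle_word (xy k w) v) n m.
Proof.
move=> xy.
by apply: (run_expansion_rec _ _ _ _
  (fun m n => shuffle_word (xy m w) (xy n v))).
Qed.

Lemma zS k : z k.+1 = Qx ^+ k * Qy.
Proof. by rewrite /z subn1. Qed.

Lemma zS_word k s :
  z k.+1 * word s = word (nseq k letter_x ++ letter_y :: s).
Proof.
rewrite zS -mulrA word_cat; elim: k => [|k IHk]; first by rewrite mul1r.
by rewrite exprS -mulrA IHk word_cat.
Qed.

Lemma zprodS p n : zprod p n.+1 = z (p n.+1) * zprod p n.
Proof. by rewrite /zprod -{1}(addn1 n) iotaD rev_cat big_cons. Qed.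

Lemma zprod_word p n : (forall i, (1 <= i <= n)%N -> (0 < p i)%N) ->
  exists s, zprod p n = word s.
Proof.
elim: n => [|n IHn] p_gt0; first by exists [::]; rewrite word_nil /zprod big_nil.
have [|s Es] := IHn.
  by move=> i /andP[i_gt0 le_i_n]; rewrite p_gt0 // i_gt0 leqW.
rewrite zprodS Es -(prednK (p_gt0 n.+1 _)) ?leqnn // zS_word.
by eexists.
Qed.

(** The claim for arbitrary words w and v after the leading factors. *)
Lemma shuffle_z_words p q w v : (0 < p)%N -> (0 < q)%N ->
  (z p * word w) \sh (z q * word v)
  = \sum_(0 <= t < q)
      'C(p - 1 + t, t)%:R *: (z (p + t) * (word w \sh (z (q - t) * word v)))
  + \sum_(0 <= t < p)
      'C(q - 1 + t, t)%:R *: (z (q + t) * ((z (p - t) * word w) \sh word v)).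
Proof.
case: p q => [//|m] [//|n] _ _.
(* Rewriting with products would test their convertibility with the other
   products of the goal, which unfolds the monoid algebra. *)
apply: etrans (congr2 shuffle (zS_word m w) (zS_word n v)) _.
apply: etrans (shuffle_words _ _) _.
apply: etrans (shuffle_word_runs _ _ _ _) _.
apply: (congr2 +%R); apply: eq_big_nat => t /andP[_ lt_t];
  rewrite scaler_nat subSS subn0 addSn zS (@subSn t _ lt_t).
- by rewrite [X in _ \sh X]zS_word shuffle_words -mulrA.
- by rewrite [X in X \sh _]zS_word shuffle_words -mulrA.
Qed.

Theorem proposition2p2 (a b : nat) (p q : nat -> nat)
  (a_gt0 : (0 < a)%N) (b_gt0 : (0 < b)%N)
  (p_gt0 : forall i, (1 <= i <= a)%N -> (0 < p i)%N)
  (q_gt0 : forall j, (1 <= j <= b)%N -> (0 < q j)%N) :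
  zprod p a \sh zprod q b
  = \sum_(0 <= t < q b)
      'C(p a - 1 + t, t)%:R *:
        (z (p a + t) * (zprod p (a - 1) \sh (z (q b - t) * zprod q (b - 1))))
  + \sum_(0 <= t < p a)
      'C(q b - 1 + t, t)%:R *:
        (z (q b + t) * ((z (p a - t) * zprod p (a - 1)) \sh zprod q (b - 1))).
Proof.
case: a b => [//|a] [//|b] in a_gt0 b_gt0 p_gt0 q_gt0 *.
rewrite !zprodS !subSS !subn0.
have [|w ->] := zprod_word p a.
  by move=> i /andP[i_gt0 le_i_a]; rewrite p_gt0 // i_gt0 leqW.
have [|v ->] := zprod_word q b.
  by move=> j /andP[j_gt0 le_j_b]; rewrite q_gt0 // j_gt0 leqW.
by apply: shuffle_z_words; [apply: p_gt0 | apply: q_gt0]; rewrite leqnn.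
Qed.
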